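(* Let $\mathbf p=(p,<_p)$ be an so-pair over $A$ with $p$ non-algebraic, and let $\mathcal D_p=\{(x,y)\in p(\mathfrak C)^2: x\mathop{\not\downarrow}_A y\}$. Then: (i) $(p(\mathfrak C),\triangleleft^{\mathbf p})$ is a strict partial order and $(p(\mathfrak C),<_p)$ is a linear extension of it; (ii) $\mathcal D_p$ and the $\triangleleft^{\mathbf p}$-incomparability relation coincide, and are a $<_p$-convex equivalence relation on $p(\mathfrak C)$; the quotient $(p(\mathfrak C)/\mathcal D_p,<_p)$ is a dense linear order.
   Context: $T$ complete (possibly multi-sorted), monster $\mathfrak C$, $A$ small. $a\mathop{\downarrow}_A B$ means $\operatorname{tp}(a/AB)$ does not fork over $A$; $\mathop{\not\downarrow}$ is its negation. For $p\in S(A)$ and a linear order $<_p$ on $p(\mathfrak C)$ that is the trace of an $A$-definable relation, $(p,<_p)$ is an so-pair over $A$ if for every relatively definable (any parameters) $X\subseteq p(\mathfrak C)$ exactly one of $X$, $p(\mathfrak C)\setminus X$ is right-eventual (contains a nonempty final segment) and exactly one is left-eventual (contains a nonempty initial segment). The right globalization $\mathbf p_r$ is the set of formulas $\phi(x)$ with parameters from $\mathfrak C$ such that $\phi(\mathfrak C)\cap p(\mathfrak C)$ is right-eventual; it is a complete global type. For $a,b\models p$, $b\triangleleft^{\mathbf p}a$ (''$a$ is right $\mathbf p$-generic over $b$'') means $a$ realizes the restriction of $\mathbf p_r$ to $A\cup\{b\}$. *)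

(* Defs.v *)
From Stdlib Require Export Relation_Definitions RelationClasses.
From mathcomp Require Export all_boot.
From mathcomp Require Export boolp classical_sets functions cardinality.

Set Implicit Arguments.
Unset Strict Implicit.
Unset Printing Implicit Defensive.

#[global] Open Scope classical_set_scope.
#[global] Open Scope card_scope.

Record language := Language {
  lsort : Type;
  fsym : Type;
  farg : fsym -> seq lsort;
  fres : fsym -> lsort;
  rsym : Type;
  rarg : rsym -> seq lsort }.

(* A finite tuple of sorted variables is a list of sorts; [var xs s] is the
   type of the positions of sort [s] in [xs], i.e. typed de Bruijn indices. *)
Inductive var (S : Type) : seq S -> S -> Type :=
| VZ : forall (s : S) (xs : seq S), var (s :: xs) s
| VS : forall (t s : S) (xs : seq S), var xs s -> var (t :: xs) s.

Inductive term (L : language) (xs : seq (lsort L)) : lsort L -> Type :=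
| Var : forall s, var xs s -> term xs s
| App : forall f : fsym L,
    (forall s, var (farg f) s -> term xs s) -> term xs (fres f).

Inductive formula (L : language) : seq (lsort L) -> Type :=
| FFalse : forall xs, formula xs
| FEq : forall xs s, term xs s -> term xs s -> formula xs
| FRel : forall xs (r : rsym L),
    (forall s, var (rarg r) s -> term xs s) -> formula xs
| FImp : forall xs, formula xs -> formula xs -> formula xs
| FAll : forall xs s, formula (s :: xs) -> formula xs.

Arguments FFalse {L xs}.

Definition FNot (L : language) (xs : seq (lsort L)) (phi : formula xs) :=
  FImp phi FFalse.

Definition tup_of (S : Type) (M : S -> Type) (xs : seq S) : Type :=
  forall s, var xs s -> M s.

Record lstructure (L : language) := LStructure {
  carrier :> lsort L -> Type;
  carrier_inh : forall s, inhabited (carrier s);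
  fint : forall f : fsym L, tup_of carrier (farg f) -> carrier (fres f);
  rint : forall r : rsym L, tup_of carrier (rarg r) -> Prop }.

Notation tup M xs := (tup_of (carrier M) xs).

Definition tnil (S : Type) (M : S -> Type) : tup_of M [::] :=
  fun s v => match v in var l s' return
               match l with [::] => M s' | _ :: _ => unit end with
             | VZ _ _ => tt
             | VS _ _ _ _ => tt
             end.

Definition tcons (S : Type) (M : S -> Type) (t : S) (xs : seq S)
    (x : M t) (a : tup_of M xs) : tup_of M (t :: xs) :=
  fun s v => match v in var l s' return
               match l with
               | [::] => unit
               | t' :: xs' => M t' -> tup_of M xs' -> M s'
               end with
             | VZ _ _ => fun x _ => x
             | VS _ s _ w => fun _ a => a s w
             end x a.

Fixpoint tcat (S : Type) (M : S -> Type) (xs ys : seq S) :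
    tup_of M xs -> tup_of M ys -> tup_of M (xs ++ ys) :=
  match xs with
  | [::] => fun _ b => b
  | t :: xs' => fun a b =>
      tcons (a t (VZ t xs')) (tcat (fun s v => a s (VS t v)) b)
  end.

Fixpoint eval (L : language) (M : lstructure L) (xs : seq (lsort L))
    (a : tup M xs) (s : lsort L) (t : term xs s) : M s :=
  match t with
  | Var s v => a s v
  | App f args => fint (fun s v => eval a (args s v))
  end.

Fixpoint sat (L : language) (M : lstructure L) (xs : seq (lsort L))
    (phi : formula xs) : tup M xs -> Prop :=
  match phi in formula xs return tup M xs -> Prop with
  | FFalse _ => fun _ => False
  | FEq _ _ t u => fun a => eval a t = eval a u
  | FRel _ _ args => fun a => rint (fun s v => eval a (args s v))
  | FImp _ phi psi => fun a => sat phi a -> sat psi a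
  | FAll _ s phi => fun a => forall x : M s, sat phi (tcons x a)
  end.

Definition theory (L : language) := set (@formula L [::]).

Definition models (L : language) (M : lstructure L) (T : theory L) : Prop :=
  forall phi, T phi -> sat phi (tnil M).

Definition entails (L : language) (T : theory L) (phi : @formula L [::]) :=
  forall M : lstructure L, models M T -> sat phi (tnil M).

Definition complete_theory (L : language) (T : theory L) : Prop :=
  (exists M : lstructure L, models M T) /\
  (forall phi, entails T phi \/ entails T (FNot phi)).

(* An element of a structure together with its sort; parameter sets are sets
   of these. *)
Definition elt (L : language) (M : lstructure L) : Type := {s : lsort L & M s}.

Definition trange (L : language) (M : lstructure L) (xs : seq (lsort L))
    (a : tup M xs) : set (elt M) :=
  [set e | exists s (v : var xs s), e = existT _ s (a s v)].

(* [PFormula phi b] is the formula phi(x, b), where phi(x, y) has no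
   parameters. *)
Record pformula (L : language) (M : lstructure L) (xs : seq (lsort L)) :=
  PFormula {
    pvars : seq (lsort L);
    pform : formula (xs ++ pvars);
    ppar : tup M pvars }.

Arguments ppar {L M xs} _ _ _.

Definition psat (L : language) (M : lstructure L) (xs : seq (lsort L))
    (phi : pformula M xs) (a : tup M xs) : Prop :=
  sat (pform phi) (tcat a (ppar phi)).

Definition pnot (L : language) (M : lstructure L) (xs : seq (lsort L))
    (phi : pformula M xs) : pformula M xs :=
  PFormula (FNot (pform phi)) (ppar phi).

Definition over (L : language) (M : lstructure L) (xs : seq (lsort L))
    (B : set (elt M)) (phi : pformula M xs) : Prop :=
  trange (ppar phi) `<=` B.

Definition finitely_satisfiable (L : language) (M : lstructure L)
    (xs : seq (lsort L)) (q : set (pformula M xs)) : Prop :=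
  forall F : set (pformula M xs), finite_set F -> F `<=` q ->
    exists a : tup M xs, forall phi, F phi -> psat phi a.

Definition realizes (L : language) (M : lstructure L) (xs : seq (lsort L))
    (a : tup M xs) (q : set (pformula M xs)) : Prop :=
  forall phi, q phi -> psat phi a.

Definition complete_type (L : language) (M : lstructure L)
    (xs : seq (lsort L)) (B : set (elt M)) (q : set (pformula M xs)) : Prop :=
  [/\ q `<=` over B,
      finitely_satisfiable q &
      forall phi, over B phi -> q phi \/ q (pnot phi)].

Definition tp (L : language) (M : lstructure L) (xs : seq (lsort L))
    (a : tup M xs) (B : set (elt M)) : set (pformula M xs) :=
  [set phi | over B phi /\ psat phi a].

Definition algebraic (L : language) (M : lstructure L) (xs : seq (lsort L))
    (q : set (pformula M xs)) : Prop :=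
  exists2 phi, q phi & finite_set [set a | psat phi a].

(* The type [K] stands for the cardinal |K|. *)
Definition small (K T : Type) (B : set T) : Prop :=
  B #<= [set: K] /\ ~ ([set: K] #<= B).

Definition saturated (K : Type) (L : language) (M : lstructure L) : Prop :=
  forall (B : set (elt M)) (xs : seq (lsort L)) (q : set (pformula M xs)),
    small K B -> q `<=` over B -> finitely_satisfiable q ->
    exists a : tup M xs, realizes a q.

Definition automorphism (L : language) (M : lstructure L)
    (sigma : forall s, M s -> M s) : Prop :=
  [/\ forall s, bijective (sigma s),
      forall (f : fsym L) (a : tup M (farg f)),
        sigma _ (fint a) = fint (fun s v => sigma s (a s v)) &
      forall (r : rsym L) (a : tup M (rarg r)),
        rint (fun s v => sigma s (a s v)) <-> rint a].

Definition elementary_on (L : language) (M : lstructure L)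
    (B : set (elt M)) (f : forall s, M s -> M s) : Prop :=
  forall (xs : seq (lsort L)) (phi : formula xs) (a : tup M xs),
    trange a `<=` B -> (sat phi a <-> sat phi (fun s v => f s (a s v))).

Definition strongly_homogeneous (K : Type) (L : language) (M : lstructure L) :
    Prop :=
  forall (B : set (elt M)) (f : forall s, M s -> M s),
    small K B -> elementary_on B f ->
    exists sigma : forall s, M s -> M s, automorphism sigma /\
      forall s (x : M s), B (existT _ s x) -> sigma s x = f s x.

(* The first four clauses say that |K| > |L| + aleph_0. *)
Definition monster (K : Type) (L : language) (T : theory L)
    (M : lstructure L) : Prop :=
  [/\ small K [set: nat], small K [set: lsort L],
      small K [set: fsym L] & small K [set: rsym L]] /\
  [/\ models M T, saturated K M & strongly_homogeneous K M].

(* The instances phi(x, b_i) are indexed by i, so k-inconsistency concerns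
   sets of k distinct indices. *)
Definition divides (L : language) (M : lstructure L) (xs : seq (lsort L))
    (A : set (elt M)) (phi : pformula M xs) : Prop :=
  exists (b : nat -> tup M (pvars phi)) (k : nat),
    (forall i, realizes (b i) (tp (ppar phi) A)) /\
    (forall I : seq nat, uniq I -> size I = k ->
      ~ exists a : tup M xs,
          forall i, i \in I -> psat (PFormula (pform phi) (b i)) a).

Definition forks (L : language) (M : lstructure L) (xs : seq (lsort L))
    (A : set (elt M)) (q : set (pformula M xs)) : Prop :=
  exists F D : set (pformula M xs),
    [/\ finite_set F, F `<=` q, finite_set D, D `<=` divides A &
        forall a : tup M xs, (forall phi, F phi -> psat phi a) ->
          exists2 psi, D psi & psat psi a].

Definition independent (L : language) (M : lstructure L)
    (xs ys : seq (lsort L)) (A : set (elt M)) (a : tup M xs) (b : tup M ys) :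
    Prop :=
  ~ forks A (tp a (A `|` trange b)).

Definition strict_linear_order (P : Type) (lt : relation P) : Prop :=
  StrictOrder lt /\ forall x y, [\/ lt x y, x = y | lt y x].

Definition dense_linear_order (P : Type) (lt : relation P) : Prop :=
  strict_linear_order lt /\
  forall x y, lt x y -> exists z, lt x z /\ lt z y.

Definition linear_extension (P : Type) (tri lt : relation P) : Prop :=
  strict_linear_order lt /\ forall x y, tri x y -> lt x y.

Definition incomparable (P : Type) (tri : relation P) : relation P :=
  fun x y => ~ tri x y /\ ~ tri y x.

Definition final_segment (P : Type) (lt : relation P) (S : set P) : Prop :=
  forall x y, S x -> lt x y -> S y.

Definition initial_segment (P : Type) (lt : relation P) (S : set P) : Prop :=
  forall x y, S y -> lt x y -> S x.

Definition right_eventual (P : Type) (lt : relation P) (X : set P) : Prop :=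
  exists S : set P, [/\ S !=set0, final_segment lt S & S `<=` X].

Definition left_eventual (P : Type) (lt : relation P) (X : set P) : Prop :=
  exists S : set P, [/\ S !=set0, initial_segment lt S & S `<=` X].

Definition convex_set (P : Type) (lt : relation P) (S : set P) : Prop :=
  forall x y z, S x -> S z -> lt x y -> lt y z -> S y.

Definition convex_equivalence (P : Type) (lt E : relation P) : Prop :=
  Equivalence E /\ forall x, convex_set lt (E x).

Definition quotient (P : Type) (E : relation P) : Type :=
  {X : set P | exists x, X = E x}.

Definition quotient_lt (P : Type) (lt E : relation P) :
    relation (quotient E) :=
  fun X Y => forall x y, proj1_sig X x -> proj1_sig Y y -> lt x y.

Arguments quotient_lt {P} lt E.

Definition exactly_one (P Q : Prop) : Prop := (P /\ ~ Q) \/ (~ P /\ Q).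

(* p(C), as a type. *)
Definition realization (L : language) (M : lstructure L) (xs : seq (lsort L))
    (p : set (pformula M xs)) : Type :=
  {a : tup M xs | realizes a p}.

Definition rtup (L : language) (M : lstructure L) (xs : seq (lsort L))
    (p : set (pformula M xs)) (a : realization p) : tup M xs :=
  proj1_sig a.

Definition trace (L : language) (M : lstructure L) (xs : seq (lsort L))
    (p : set (pformula M xs)) (phi : pformula M xs) : set (realization p) :=
  [set a | psat phi (rtup a)].

Arguments trace {L M xs} p phi.

Definition so_pair (L : language) (M : lstructure L) (xs : seq (lsort L))
    (A : set (elt M)) (p : set (pformula M xs))
    (lt : relation (realization p)) : Prop :=
  [/\ complete_type A p,
      strict_linear_order lt,
      exists2 phi : pformula M (xs ++ xs), over A phi &
        forall a b, lt a b <-> psat phi (tcat (rtup a) (rtup b)) &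
      forall X : set (realization p),
        (exists phi : pformula M xs, X = trace p phi) ->
        exactly_one (right_eventual lt X) (right_eventual lt (~` X)) /\
        exactly_one (left_eventual lt X) (left_eventual lt (~` X))].

Definition right_globalization (L : language) (M : lstructure L)
    (xs : seq (lsort L)) (p : set (pformula M xs))
    (lt : relation (realization p)) : set (pformula M xs) :=
  [set phi | right_eventual lt (trace p phi)].

(* [tri A lt b a] : a is right generic over b. *)
Definition tri (L : language) (M : lstructure L) (xs : seq (lsort L))
    (A : set (elt M)) (p : set (pformula M xs))
    (lt : relation (realization p)) : relation (realization p) :=
  fun b a =>
    realizes (rtup a) (right_globalization lt `&` over (A `|` trange (rtup b))).

Definition dep (L : language) (M : lstructure L) (xs : seq (lsort L))
    (A : set (elt M)) (p : set (pformula M xs)) : relation (realization p) :=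
  fun x y => ~ independent A (rtup x) (rtup y).

Arguments dep {L M xs} A p.

(* Main.v *)
(* Right genericity (z is right generic over x, below x <| z) is invariant under
   automorphisms over A, and by saturation and homogeneity the z with x <| z form
   a single orbit over Ax, which contains elements beyond any given point.
   Moving elements inside that orbit shows that it is a final segment, and that
   x <| z implies x <| y or y <| z for every y, so incomparability is an
   equivalence relation. The asymmetry between the two sides disappears because
   z is right generic over x iff x is left generic over z. Hence comparability
   gives independence: both globalizations are A-invariant, so they contain no
   dividing formula. Conversely, if x is neither left nor right generic over y, a
   formula in tp(x/Ay) confines x to an interval of p(C). Moving y far to the
   right makes the intervals disjoint, and along a sequence of successive right
   generics this formula (intersected with an A-formula of p) 2-divides. *)
From Stdlib Require List.
Require Import Defs.

Set Implicit Arguments.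
Unset Strict Implicit.
Unset Printing Implicit Defensive.

(** * Cardinality of small sets; finite sets as lists *)

(** [A] contains a copy [N] of the naturals. The countable union of [N] and [D] is injected back
    into [N], and everything else stays fixed. *)
Lemma infinite_setU_countable_le (T : Type) (A D : set T) :
  infinite_set A -> countable D -> A `|` D #<= A.
Proof.
elim/Ppointed: T A D => [T A D _ _|T A D /infiniteP/pcard_leP/injfunPex[h hA hI] Dc].
  by rewrite (empty_eq0 (A `|` D)) card_ge0.
pose N := range h.
have NDc : countable (N `|` D).
  have -> : N `|` D = \bigcup_(b in [set: bool]) (if b then N else D).
    apply/seteqP; split=> [x [Nx|Dx]|x [[] _ Hx]]; first by exists true.
    - by exists false.
    - by left.
    - by right.
  apply: bigcup_countable => // -[] _ //.
  by apply: sub_countable (countableP [set: nat]); exact: card_image_le.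
case/countable_injP: NDc => g gI.
apply/pcard_leP/injfunPex.
exists (fun x => if x \in N `|` D then h (g x) else x).
  move=> x /= ADx; case: ifPn => [_|]; first exact: hA.
  rewrite notin_setE => ND; case: ADx => // Dx; case: ND; by right.
move=> x y _ _.
have hN (n : nat) (z : T) : z \notin N `|` D -> h n <> z.
  by rewrite notin_setE => ND hz; apply: ND; left; exists n.
case: ifPn => Hx; case: ifPn => Hy => //.
- by move/hI => /(_ (in_setT _) (in_setT _)) /gI; apply.
- by move/(hN _ _ Hy).
- by move/esym/(hN _ _ Hx).
Qed.

(** If [A] is finite the union is countable; otherwise adding [F] does not raise the cardinal of
    [A]. This keeps [A] plus finitely many tuples within reach of saturation and homogeneity. *)
Lemma small_setU_finite (K T : Type) (A F : set T) :
  small K [set: nat] -> small K A -> finite_set F -> small K (A `|` F).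
Proof.
move=> [natK Knat] [AK KA] finF.
have [finA|infA] := pselect (finite_set A).
  have cAF : A `|` F #<= [set: nat].
    by apply: finite_set_countable; rewrite finite_setU.
  split; first exact: card_le_trans natK.
  by move=> H; apply: Knat; apply: card_le_trans cAF.
have AFA := infinite_setU_countable_le infA (finite_set_countable finF).
split; first exact: card_le_trans AK.
by move=> H; apply: KA; apply: card_le_trans AFA.
Qed.

Lemma finite_set_listP (T : Type) (F : set T) :
  finite_set F -> exists l : list T, forall x, F x <-> List.In x l.
Proof.
elim/Pchoice: T F => T F /finite_seqP[l ->]; exists l => x /=.
elim: l => [|y l IH] /=; first by rewrite in_nil.
rewrite in_cons; split=> [/orP[/eqP->|/IH]|[->|/IH ->]]; [by left|by right| |].
- by rewrite eqxx.
- by rewrite orbT.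
Qed.

(** * Renaming of variables *)

Section Variables.
Variable S : Type.
Implicit Types (xs ys zs : seq S) (M N : S -> Type).

Lemma var_cons_ind t xs (P : forall s, var (t :: xs) s -> Prop) :
  P t (VZ t xs) -> (forall s (v : var xs s), P s (VS t v)) ->
  forall s (v : var (t :: xs) s), P s v.
Proof.
move=> H0 HS s v.
refine (match v as v0 in var l s0 return
  match l return var l s0 -> Prop with
  | [::] => fun _ => True
  | t' :: xs' => fun v0 => forall P : forall s, var (t' :: xs') s -> Prop,
     P t' (VZ t' xs') -> (forall s (w : var xs' s), P s (VS t' w)) -> P s0 v0
  end v0 with VZ _ _ => _ | VS _ _ _ _ => _ end P H0 HS).
- by move=> ? ? ?.
- by move=> Q _ HQ; apply: HQ.
Qed.

Lemma var_nil (s : S) (v : var [::] s) : False.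
Proof.
by refine (match v in var l _ return
  match l with [::] => False | _ => True end with VZ _ _ => I | VS _ _ _ _ => I end).
Qed.

Definition tmap M N (f : forall s, M s -> N s) xs (a : tup_of M xs) :
  tup_of N xs := fun s v => f s (a s v).

Lemma tup_ext M xs (a b : tup_of M xs) : (forall s v, a s v = b s v) -> a = b.
Proof. by move=> H; apply: functional_extensionality_dep => s; apply: funext. Qed.

Lemma tmap_tcons M N (f : forall s, M s -> N s) t xs (x : M t) (a : tup_of M xs) :
  tmap f (tcons x a) = tcons (f t x) (tmap f a).
Proof. by apply: tup_ext; apply: var_cons_ind. Qed.

Lemma tmap_tcat M N (f : forall s, M s -> N s) xs ys
    (a : tup_of M xs) (b : tup_of M ys) :
  tmap f (tcat a b) = tcat (tmap f a) (tmap f b).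
Proof. by elim: xs a => [|t xs IH] a //=; rewrite tmap_tcons IH. Qed.

Fixpoint vinl xs ys s (v : var xs s) : var (xs ++ ys) s :=
  match v in var l s0 return var (l ++ ys) s0 with
  | VZ t l => VZ t (l ++ ys)
  | VS t _ _ w => VS t (vinl ys w)
  end.

Fixpoint vinr xs ys s (v : var ys s) : var (xs ++ ys) s :=
  match xs with
  | [::] => v
  | t :: l => VS t (vinr l v)
  end.

Lemma tcat_vinl M xs ys (a : tup_of M xs) (b : tup_of M ys) s (v : var xs s) :
  tcat a b (vinl ys v) = a s v.
Proof.
elim: xs a s v => [a s v|t xs IH a]; first by case: (var_nil v).
by apply: var_cons_ind => //= s v; rewrite IH.
Qed.

Lemma tcat_vinr M xs ys (a : tup_of M xs) (b : tup_of M ys) s (v : var ys s) :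
  tcat a b (vinr xs v) = b s v.
Proof. by elim: xs a => //= t xs IH a; rewrite IH. Qed.

Lemma var_cat_ind xs ys (P : forall s, var (xs ++ ys) s -> Prop) :
  (forall s (v : var xs s), P s (vinl ys v)) ->
  (forall s (v : var ys s), P s (vinr xs v)) -> forall s v, P s v.
Proof.
elim: xs P => [//|t xs IH] P Hl Hr; apply: var_cons_ind.
- exact: (Hl t (VZ t xs)).
- by apply: IH => s v; [exact: (Hl s (VS t v))|exact: Hr].
Qed.

Lemma finite_var xs : finite_set [set: {s : S & var xs s}].
Proof.
elim: xs => [|t xs IH].
  by apply: (@sub_finite_set _ _ set0) => // -[s v]; case: (var_nil v).
pose f (u : {s : S & var xs s}) := existT (var (t :: xs)) _ (VS t (projT2 u)).
apply: (@sub_finite_set _ _ ([set existT _ t (VZ t xs)] `|` range f)).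
  move=> [s v] _; move: s v; apply: var_cons_ind; first by left.
  by move=> s v; right; exists (existT _ s v).
by rewrite finite_setU; split; [exact: finite_set1|exact: finite_image].
Qed.

Definition vlift t xs ys (r : tup_of (var ys) xs) :
    tup_of (var (t :: ys)) (t :: xs) :=
  tcons (VZ t ys) (tmap (fun s => @VS S t s ys) r).

End Variables.

Section Renaming.
Variable L : language.
Implicit Types (xs ys zs : seq (lsort L)) (M : lstructure L).

Fixpoint term_ren xs ys (r : tup_of (var ys) xs) s (t : term xs s) : term ys s :=
  match t with
  | Var _ v => Var (r _ v)
  | App f args => App (fun s v => term_ren r (args s v))
  end.

Lemma eval_ren M xs ys (r : tup_of (var ys) xs) (a : tup M ys) s (t : term xs s) :
  eval a (term_ren r t) = eval (tmap a r) t.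
Proof. by elim: t => //= f args IH; congr fint; exact: tup_ext. Qed.

Fixpoint form_ren xs (phi : formula xs) : forall ys, tup_of (var ys) xs -> formula ys :=
  match phi in formula xs0 return forall ys, tup_of (var ys) xs0 -> formula ys with
  | FFalse _ => fun _ _ => FFalse
  | FEq _ _ t u => fun _ r => FEq (term_ren r t) (term_ren r u)
  | FRel _ _ args => fun _ r => FRel (fun s v => term_ren r (args s v))
  | FImp _ phi psi => fun _ r => FImp (form_ren phi r) (form_ren psi r)
  | FAll _ s phi => fun _ r => FAll (form_ren phi (vlift r))
  end.

Lemma sat_ren M xs (phi : formula xs) ys (r : tup_of (var ys) xs) (a : tup M ys) :
  sat (form_ren phi r) a <-> sat phi (tmap a r).
Proof.
elim: phi ys r a => {xs}
  [xs|xs s t u|xs R args|xs phi IH1 psi IH2|xs s phi IH] ys r a //=.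
- by rewrite !eval_ren.
- have -> // : (fun s v => eval a (term_ren r (args s v))) =
    (fun s v => eval (tmap a r) (args s v)).
  by apply: tup_ext => s v; rewrite eval_ren.
- by split=> H /IH1/H/IH2.
- by split=> H x; move: (H x); rewrite IH /vlift tmap_tcons.
Qed.

End Renaming.

(** * Weak orders *)

(** The third hypothesis makes the negation of [R] transitive, so incomparability is an equivalence.
    [R] absorbs [lt] on both sides, which gives convexity; between different classes the two agree,
    so density passes to the quotient. *)
Lemma weak_order_quotient (P : Type) (lt R : relation P) :
  strict_linear_order lt -> (forall x y, R x y -> lt x y) ->
  (forall x y z, R x z -> R x y \/ R y z) ->
  (forall x z, R x z -> exists y, R x y /\ R y z) ->
  [/\ StrictOrder R, convex_equivalence lt (incomparable R) &
      dense_linear_order (quotient_lt lt (incomparable R))].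
Proof.
move=> [[irr trans] tot] Rlt Rweak Rdense.
have asym x y : lt x y -> lt y x -> False.
  by move=> xy yx; exact: irr x (trans _ _ _ xy yx).
have Rfin x y z : R x y -> lt y z -> R x z.
  by move=> xy yz; case: (Rweak x z y xy) => // /Rlt/(asym _ _ yz).
have Rini x y z : lt x y -> R y z -> R x z.
  by move=> xy yz; case: (Rweak y x z yz) => // /Rlt/(asym _ _ xy).
have Rtri x y : incomparable R x y \/ R x y \/ R y x.
  have [|nxy] := pselect (R x y); first by right; left.
  by have [|nyx] := pselect (R y x); [right; right|left].
have Eeq : Equivalence (incomparable R).
  split=> [x|x y []|x y z [nxy nyx] [nyz nzy]]; first by split=> /Rlt/irr.
    by [].
  by split=> [/(Rweak _ y)|/(Rweak _ y)] [].
have Rblock x x' y y' : incomparable R x x' -> incomparable R y y' -> R x y -> R x' y'.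
  move=> [nxx' _] [_ ny'y] /(Rweak _ x')[//|/(Rweak _ y')[//|]]; by [].
have Rclass (X : quotient (incomparable R)) x :
    sval X x -> sval X = incomparable R x.
  case: X => X [x0 E] /=; rewrite E => x0x; apply/seteqP; split=> u.
    by apply: Equivalence_Transitive; exact: Equivalence_Symmetric.
  exact: Equivalence_Transitive.
have Rrep (X : quotient (incomparable R)) : exists x, sval X x.
  by case: X => X [x E] /=; exists x; rewrite E; exact: Equivalence_Reflexive.
have Rquot x y (X Y : quotient (incomparable R)) :
    sval X x -> sval Y y -> R x y -> quotient_lt lt (incomparable R) X Y.
  move=> /Rclass XE /Rclass YE xy x' y'; rewrite XE YE => xx' yy'.
  exact/Rlt/(Rblock x x' y y').
split.
- split=> [x /Rlt/irr //|x y z xy /Rlt]; exact: Rfin.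
- split=> // x a b c [nxa nax] [nxc ncx] ab bc; split=> H.
    by apply: nxc; exact: Rfin bc.
  by apply: nax; exact: Rini H.
- split; first split; first split.
  + by move=> X XX; have [x Xx] := Rrep X; exact: irr (XX _ _ Xx Xx).
  + move=> X Y Z XY YZ x z Xx Zz; have [y Yy] := Rrep Y.
    exact: trans (XY _ _ Xx Yy) (YZ _ _ Yy Zz).
  + move=> X Y; have [x Xx] := Rrep X; have [y Yy] := Rrep Y.
    case: (Rtri x y) => [xy|[xy|yx]].
    * apply: Or32; move: (Rclass _ _ Xx) (Rclass _ _ Yy).
      have -> : incomparable R x = incomparable R y.
        apply/seteqP; split=> u; apply: Equivalence_Transitive => //.
        exact: Equivalence_Symmetric.
      by case: X Y {Xx Yy} => [X ?] [Y ?] /= XE YE; apply: eq_exist; rewrite XE YE.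
    * by apply: Or31; exact: Rquot xy.
    * by apply: Or33; exact: Rquot yx.
  + move=> X Y XY; have [x Xx] := Rrep X; have [y Yy] := Rrep Y.
    have xy := XY _ _ Xx Yy; case: (Rtri x y) => [Exy|[/Rdense[z [xz zy]]|/Rlt yx]].
    (* Incomparable [x] and [y] would put [y] in both classes, giving [lt y y]. *)
    * have Xy : sval X y by rewrite (Rclass _ _ Xx).
      by case: (irr _ (XY _ _ Xy Yy)).
    * pose Z : quotient (incomparable R) :=
        exist _ (incomparable R z) (ex_intro _ z erefl).
      have Zz : sval Z z by exact: Equivalence_Reflexive.
      by exists Z; split; [exact: Rquot xz|exact: Rquot zy].
    * by case: (asym _ _ xy yx).
Qed.

(** * Elements occurring in a tuple *)

Lemma trangeP (L : language) (M : lstructure L) (xs : seq (lsort L))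
    (a : tup M xs) s (e : M s) :
  trange a (existT _ s e) <-> exists v : var xs s, e = a s v.
Proof.
split=> [[s' [v E]]|[v ->]]; last by exists s, v.
pose Q (u : elt M) := exists v : var xs (projT1 u), projT2 u = a _ v.
change (Q (existT _ s e)); rewrite E; by exists v.
Qed.

Lemma finite_trange (L : language) (M : lstructure L) (xs : seq (lsort L))
    (a : tup M xs) : finite_set (trange a).
Proof.
pose f (u : {s : lsort L & var xs s}) : elt M := existT _ _ (a _ (projT2 u)).
apply: (@sub_finite_set _ _ (range f)); last exact/finite_image/finite_var.
by move=> _ [s [v ->]]; exists (existT _ s v).
Qed.

(** * Sets definable over parameters *)

Section Definability.
Variables (L : language) (M : lstructure L).
Implicit Types (xs ys zs : seq (lsort L)) (B : set (elt M)).

Definition definable xs B (X : set (tup M xs)) : Prop :=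
  exists2 phi : pformula M xs, over B phi & forall a, psat phi a <-> X a.

Lemma trange_tcons_sub t ys (x : M t) (c : tup M ys) B :
  B (existT _ t x) -> trange c `<=` B -> trange (tcons x c) `<=` B.
Proof.
move=> Bx Bc _ [s [v ->]]; move: s v; apply: var_cons_ind => //= s v.
by apply: Bc; exists s, v.
Qed.

Lemma over_coord xs B (phi : pformula M xs) s (v : var (pvars phi) s) :
  over B phi -> B (existT _ s (ppar phi s v)).
Proof. by apply; exists s, v. Qed.

Lemma over_sub xs B B' (phi : pformula M xs) : B `<=` B' -> over B phi -> over B' phi.
Proof. by move=> sB oB; apply: subset_trans sB. Qed.

Lemma definable_sub xs B B' (X : set (tup M xs)) :
  B `<=` B' -> definable B X -> definable B' X.
Proof. by move=> sB [phi o E]; exists phi => //; exact: over_sub o. Qed.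

Lemma definable_psat xs B (phi : pformula M xs) :
  over B phi -> definable B [set a | psat phi a].
Proof. by move=> o; exists phi. Qed.

(** Each coordinate of [g a] is a coordinate of [a] or a constant from [B]. The constants are
    gathered into one parameter tuple, and a renaming of [phi] does the substitution. *)
Lemma definable_subst xs ys B (phi : formula ys) (g : tup M xs -> tup M ys) :
  (forall s (v : var ys s), (exists w : var xs s, forall a, g a s v = a s w) \/
     (exists2 c : M s, B (existT _ s c) & forall a, g a s v = c)) ->
  definable B [set a | sat phi (g a)].
Proof.
move=> gP.
suff [zs [c [r [Bc gE]]]] : exists zs (c : tup M zs) (r : tup_of (var (xs ++ zs)) ys),
    trange c `<=` B /\ forall a, g a = tmap (tcat a c) r.
  exists (PFormula (form_ren phi r) c) => // a.
  by rewrite /psat sat_ren -gE.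
elim: ys {phi} g gP => [|t ys IH] g gP.
  exists [::], (tnil M), (fun s v => False_rect _ (var_nil v)); split.
    by move=> e [s [v _]]; exfalso; exact: var_nil v.
  by move=> a; apply: tup_ext => s v; case: (var_nil v).
have [|zs [c [r [Bc gE]]]] := IH (fun a s v => g a s (VS t v)).
  by move=> s v; exact: gP.
have {}gE a s (v : var ys s) : g a s (VS t v) = tmap (tcat a c) r v.
  by rewrite -gE.
case: (gP t (VZ t ys)) => [[w wE]|[e Be eE]].
- exists zs, c, (tcons (vinl zs w) r); split=> // a; apply: tup_ext.
  apply: var_cons_ind => [|s v]; first by rewrite /tmap /= tcat_vinl.
  by rewrite gE.
- pose r' := tmap (tcat (@vinl _ xs (t :: zs))
                     (fun s v => vinr xs (@VS _ t s zs v))) r.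
  exists (t :: zs), (tcons e c), (tcons (vinr xs (VZ t zs)) r'); split.
    exact: trange_tcons_sub.
  move=> a; apply: tup_ext; apply: var_cons_ind => [|s v].
    by rewrite /tmap /= tcat_vinr.
  rewrite gE /tmap /= /r' /tmap; move: (r s v) => w {v}; move: s w.
  by apply: var_cat_ind => s w; rewrite ?tcat_vinl ?tcat_vinr.
Qed.

Lemma definable_not xs B (X : set (tup M xs)) :
  definable B X -> definable B (~` X).
Proof. by move=> [phi o E]; exists (pnot phi) => // a; split=> H /E/H. Qed.

Lemma definable_and xs B (X Y : set (tup M xs)) :
  definable B X -> definable B Y -> definable B (X `&` Y).
Proof.
move=> [[zs phi c] /= oc EX] [[zs' psi d] /= od EY].
(* Conjunction is coded by implication and falsity; [a] is duplicated so that the two formulas keep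
   separate contexts. *)
pose chi := FNot (FImp (form_ren phi (@vinl _ (xs ++ zs) (xs ++ zs')))
                       (FNot (form_ren psi (@vinr _ (xs ++ zs) (xs ++ zs'))))).
have [|th oth E] :=
    @definable_subst xs _ B chi (fun a => tcat (tcat a c) (tcat a d)).
  apply: var_cat_ind => s v.
  - move: s v; apply: var_cat_ind => s v.
    + by left; exists v => a; rewrite !tcat_vinl.
    + right; exists (c s v); first by apply: oc; exists s, v.
      by move=> a; rewrite tcat_vinl tcat_vinr.
  - move: s v; apply: var_cat_ind => s v.
    + by left; exists v => a; rewrite tcat_vinr tcat_vinl.
    + right; exists (d s v); first by apply: od; exists s, v.
      by move=> a; rewrite !tcat_vinr.
exists th => // a; rewrite E /= !sat_ren.
have -> : tmap (tcat (tcat a c) (tcat a d)) (@vinl _ _ (xs ++ zs')) = tcat a c.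
  by apply: tup_ext => s v; exact: tcat_vinl.
have -> : tmap (tcat (tcat a c) (tcat a d)) (@vinr _ (xs ++ zs) _) = tcat a d.
  by apply: tup_ext => s v; exact: tcat_vinr.
split=> [H|[/EX Hx /EY Hy] H]; last exact: H Hx Hy.
by apply: contrapT => nH; apply: H => Hx Hy; apply: nH; split; [exact/EX|exact/EY].
Qed.

Lemma definable_setT xs B : definable B [set: tup M xs].
Proof.
have [|phi o E] := @definable_subst xs [::] B (FImp FFalse FFalse) (fun _ => tnil M).
  by move=> s v; case: (var_nil v).
by exists phi => // a; split=> // _; exact: (E a).2.
Qed.

Lemma definable_list xs B (I : Type) (l : list I) (X : I -> set (tup M xs)) :
  (forall i, List.In i l -> definable B (X i)) ->
  definable B [set a | forall i, List.In i l -> X i a].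
Proof.
elim: l => [_|i l IH Xd].
  have [phi o E] := definable_setT xs B.
  by exists phi => // a; split=> [_ i []|_]; exact: (E a).2.
have Xid : definable B (X i) by apply: Xd; left.
have [|phi o E] := definable_and Xid (IH _).
  by move=> j jl; apply: Xd; right.
exists phi => // a; rewrite E; split=> [[Xi Xl] j [<-//|]|H]; first exact: Xl.
by split=> [|j jl]; apply: H; [left|right].
Qed.

Lemma definable_coord_eq xs B s (v w : var xs s) :
  definable B [set a : tup M xs | a s v = a s w].
Proof.
pose phi : formula [:: s; s] := FEq (Var (VZ s [:: s])) (Var (VS s (VZ s [::]))).
have [|psi o E] := @definable_subst xs _ B phi
    (fun a => tcons (a s v) (tcons (a s w) (tnil M))).
  apply: var_cons_ind; first by left; exists v.
  apply: var_cons_ind; first by left; exists w.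
  by move=> t u; case: (var_nil u).
by exists psi.
Qed.

Lemma definable_coord_const xs B s (v : var xs s) (e : M s) :
  B (existT _ s e) -> definable B [set a : tup M xs | a s v = e].
Proof.
move=> Be.
pose phi : formula [:: s; s] := FEq (Var (VZ s [:: s])) (Var (VS s (VZ s [::]))).
have [|psi o E] := @definable_subst xs _ B phi
    (fun a => tcons (a s v) (tcons e (tnil M))).
  apply: var_cons_ind; first by left; exists v.
  apply: var_cons_ind; first by right; exists e.
  by move=> t u; case: (var_nil u).
by exists psi.
Qed.

Lemma definable_eq xs B (b : tup M xs) : trange b `<=` B ->
  definable B [set a | a = b].
Proof.
move=> bB; have [l lP] := finite_set_listP (finite_var xs).
pose X (u : {s : lsort L & var xs s}) : set (tup M xs) :=
  [set a : tup M xs | a _ (projT2 u) = b _ (projT2 u)].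
have [|phi o E] := @definable_list xs B _ l X.
  by move=> u _; apply: definable_coord_const; apply: bB; eexists; exists (projT2 u).
exists phi => // a; rewrite E; split=> [H|-> //].
by apply: tup_ext => s v; exact: (H (existT _ s v) ((lP _).1 I)).
Qed.

(* Replaces by [b'] the entries of [b] lying outside [B]. *)
Definition moved B xs (b b' : tup M xs) s (e : M s) : M s :=
  match pselect (B (existT _ s e)), pselect (exists v : var xs s, b s v = e) with
  | right _, left h => b' s (projT1 (cid h))
  | _, _ => e
  end.

Lemma moved_id B xs (b : tup M xs) s (e : M s) : moved B b b e = e.
Proof.
rewrite /moved; case: pselect => // _; case: pselect => // h; exact: projT2 (cid h).
Qed.

Lemma moved_fix B xs (b b' : tup M xs) s (e : M s) :
  B (existT _ s e) -> moved B b b' e = e.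
Proof. by move=> Be; rewrite /moved; case: pselect. Qed.

(** The position [v] depends on [e] alone, so the moved entry is the same coordinate of [b'] for
    every [b'], as [definable_subst] requires. *)
Lemma moved_coord B xs (b : tup M xs) s (e : M s) :
  (B `|` trange b) (existT _ s e) -> ~ B (existT _ s e) ->
  exists v : var xs s, b s v = e /\ forall b', moved B b b' e = b' s v.
Proof.
move=> Be nBe; have [//|/trangeP[v ve]] := Be.
have h : exists v : var xs s, b s v = e by exists v.
exists (projT1 (cid h)); split; first exact: projT2 (cid h).
move=> b'; rewrite /moved; case: pselect => // _; case: pselect => // h'.
by rewrite (Prop_irrelevance h h').
Qed.

(** A statement about parameters in [B] and [b] thus becomes a condition over [B] on the tuple put
    in place of [b]. *)
Lemma definable_moved B xs (b : tup M xs) ys (phi : formula ys) (c : tup M ys) :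
  trange c `<=` B `|` trange b ->
  definable B [set b' | sat phi (tmap (moved B b b') c)].
Proof.
move=> cB; apply: definable_subst => s v.
have [Bv|nBv] := pselect (B (existT _ s (c s v))).
- by right; exists (c s v) => // b'; rewrite /tmap moved_fix.
- have [|w [_ wE]] := @moved_coord B xs b s (c s v) _ nBv.
    by apply: cB; exists s, v.
  by left; exists w.
Qed.

End Definability.

(** * Automorphisms, homogeneity and compactness *)

Section Automorphisms.
Variables (L : language) (M : lstructure L).
Implicit Types (xs ys zs : seq (lsort L)) (B : set (elt M)).
Implicit Types sigma tau : forall s, M s -> M s.

Lemma eval_aut sigma xs (a : tup M xs) s (t : term xs s) :
  automorphism sigma -> eval (tmap sigma a) t = sigma s (eval a t).
Proof.
move=> [_ sF _]; elim: t => //= f args IH.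
by rewrite sF; congr fint; exact: tup_ext.
Qed.

Lemma sat_aut sigma xs (phi : formula xs) (a : tup M xs) :
  automorphism sigma -> sat phi (tmap sigma a) <-> sat phi a.
Proof.
move=> sA; have [sB _ sR] := sA.
elim: phi a => {xs} [xs|xs s t u|xs R args|xs phi IH1 psi IH2|xs s phi IH] a //=.
- by rewrite !eval_aut //; split=> [/(bij_inj (sB s))|->].
- rewrite (_ : (fun s v => eval (tmap sigma a) (args s v)) =
    (fun s v => sigma s (eval a (args s v)))); first exact: sR.
  by apply: tup_ext => s v; rewrite eval_aut.
- by rewrite IH1 IH2.
- have [g sg gs] := sB s; split=> H x.
  + by rewrite -IH tmap_tcons.
  + by rewrite -(gs x) -tmap_tcons IH.
Qed.

Definition aut_over B sigma : Prop :=
  automorphism sigma /\ forall s (x : M s), B (existT _ s x) -> sigma s x = x.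

Lemma aut_over_sub B B' sigma : B `<=` B' -> aut_over B' sigma -> aut_over B sigma.
Proof. by move=> sB [sA sF]; split=> // s x /sB; exact: sF. Qed.

Lemma aut_over_inv B sigma : aut_over B sigma ->
  exists2 tau, aut_over B tau &
    (forall xs (a : tup M xs), tmap sigma (tmap tau a) = a) /\
    (forall xs (a : tup M xs), tmap tau (tmap sigma a) = a).
Proof.
move=> [[sB sF sR] sfix].
have [tau tauP] : exists tau : forall s, M s -> M s,
    forall s, cancel (sigma s) (tau s) /\ cancel (tau s) (sigma s).
  have H s : exists g : M s -> M s, cancel (sigma s) g /\ cancel g (sigma s).
    by have [g] := sB s; exists g.
  by exists (fun s => projT1 (cid (H s))) => s; exact: projT2 (cid (H s)).
have sK xs (a : tup M xs) : tmap sigma (tmap tau a) = a.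
  by apply: tup_ext => s v; exact: (tauP s).2.
exists tau; last by split=> // xs a; apply: tup_ext => s v; exact: (tauP s).1.
split; last by move=> s x Bx; rewrite -{1}(sfix _ _ Bx) (tauP s).1.
split=> [s|f a|r a].
- by exists (sigma s); [exact: (tauP s).2|exact: (tauP s).1].
- by rewrite -{1}(sK _ a) -sF (tauP _).1.
- by rewrite -{2}(sK _ a) sR.
Qed.

Lemma aut_over_comp B sigma tau : aut_over B sigma -> aut_over B tau ->
  aut_over B (fun s x => tau s (sigma s x)).
Proof.
move=> [[sB sF sR] sfix] [[tB tF tR] tfix]; split; last first.
  by move=> s x Bx; rewrite sfix // tfix.
split=> [s|f a|r a]; first exact: bij_comp.
- by rewrite sF tF.
- by rewrite tR sR.
Qed.

Lemma tmap_fix B sigma xs (c : tup M xs) :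
  aut_over B sigma -> trange c `<=` B -> tmap sigma c = c.
Proof. by move=> [_ sF] cB; apply: tup_ext => s v; apply/sF/cB; exists s, v. Qed.

Lemma tmap_agree B sigma tau ys (b : tup M ys) xs (c : tup M xs) :
  aut_over B sigma -> aut_over B tau -> tmap sigma b = tmap tau b ->
  trange c `<=` B `|` trange b -> tmap sigma c = tmap tau c.
Proof.
move=> [_ sF] [_ tF] E cB; apply: tup_ext => s v.
have [|Bc|/trangeP[w]] := cB (existT _ s (c s v)); first by exists s, v.
- by rewrite /tmap sF // tF.
- by rewrite /tmap => ->; exact: (congr1 (fun a => a s w) E).
Qed.

Definition pact sigma xs (phi : pformula M xs) : pformula M xs :=
  PFormula (pform phi) (tmap sigma (ppar phi)).

Lemma psat_pact sigma xs (phi : pformula M xs) (a : tup M xs) :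
  automorphism sigma -> psat (pact sigma phi) (tmap sigma a) <-> psat phi a.
Proof. by move=> sA; rewrite /psat /= -tmap_tcat sat_aut. Qed.

Lemma psat_aut B sigma xs (phi : pformula M xs) (a : tup M xs) :
  aut_over B sigma -> over B phi -> psat phi (tmap sigma a) <-> psat phi a.
Proof.
move=> sA o; rewrite -(psat_pact _ a sA.1).
by rewrite /psat /= (tmap_fix sA o).
Qed.

Lemma over_pact B sigma ys (b : tup M ys) xs (phi : pformula M xs) :
  aut_over B sigma -> over (B `|` trange b) phi ->
  over (B `|` trange (tmap sigma b)) (pact sigma phi).
Proof.
move=> [_ sF] o; move=> _ [s [v ->]] /=.
have [Bc|/trangeP[w]] := @over_coord _ _ _ _ phi s v o.
- by left; rewrite /tmap sF.
- by rewrite /tmap => ->; right; exists s, w.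
Qed.

Variables (K : Type) (hom : strongly_homogeneous K M) (sat_M : saturated K M).
Hypothesis natK : small K [set: nat].

(** The map fixing [B] and sending [b] to [b'] is elementary: by [definable_moved], a formula about
    [B] and [b] is a formula over [B] satisfied by [b], and complements give the converse. *)
Lemma homogeneous B xs (b b' : tup M xs) : small K B ->
  (forall phi : pformula M xs, over B phi -> psat phi b -> psat phi b') ->
  exists2 sigma, aut_over B sigma & tmap sigma b = b'.
Proof.
move=> sB bb'.
have dbb' (X : set (tup M xs)) : definable B X -> X b -> X b'.
  by move=> [phi o E] /E Xb; apply/E; exact: bb'.
have [sigma [sA sE]] : exists sigma, automorphism sigma /\
    forall s (x : M s), (B `|` trange b) (existT _ s x) -> sigma s x = moved B b b' x.
  apply: hom; first by apply: small_setU_finite => //; exact: finite_trange.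
  move=> ys phi a aB.
  have X := definable_moved phi aB.
  have E : tmap (moved B b b) a = a by apply: tup_ext => s v; exact: moved_id.
  split=> H; first by apply: (dbb' _ X); rewrite /= E.
  by apply: contrapT => nH; apply: (dbb' _ (definable_not X)) H; rewrite /= E.
exists sigma.
  by split=> // s x Bx; rewrite sE ?moved_fix //; left.
apply: tup_ext => s v; rewrite /tmap sE; last by right; exists s, v.
(* An entry of [b] lying in [B] is forced to be the same in [b']; an entry repeated in [b] is
   repeated in [b'] at the same positions. *)
have [Bv|nBv] := pselect (B (existT _ s (b s v))).
  rewrite moved_fix //; apply/esym.
  exact: (dbb' _ (definable_coord_const v Bv) erefl).
have [|w [wv ->]] := @moved_coord _ _ B xs b s (b s v) _ nBv.
  by right; exists s, v.
exact: (dbb' _ (definable_coord_eq B w v) wv).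
Qed.

(** Compactness: [q] with [X] has no realization, so finitely many formulas of [q] already exclude
    [X], and [Y] is their conjunction. *)
Lemma type_separation B B' xs (q : set (pformula M xs)) (X : set (tup M xs)) :
  small K B -> B' `<=` B -> q `<=` over B' -> definable B X ->
  (forall a, realizes a q -> ~ X a) ->
  exists Y : set (tup M xs),
    [/\ definable B' Y, (forall a, realizes a q -> Y a) & Y `&` X = set0].
Proof.
move=> sB sB' qB' [phi o E] qX; apply: contrapT => H.
have [|F finF Fq|a aq] := @sat_M B xs (q `|` [set phi]) sB.
- by move=> psi [/qB'|->] //; exact: over_sub.
- have [l lP] := finite_set_listP finF.
  pose Z psi : set (tup M xs) := [set a | q psi -> psat psi a].
  have [|th oth Eth] := @definable_list _ _ xs B' _ l Z.
    move=> psi _; have [qpsi|nq] := pselect (q psi).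
      by exists psi => [|a]; [exact: qB'|split=> [Pa _|]; [exact: Pa|exact]].
    have [th oth Eth] := definable_setT xs B'.
    by exists th => // a; split=> [_ /nq //|_]; exact: (Eth a).2.
  apply: contrapT => nF; apply: H; exists [set a | psat th a]; split.
  - exact: definable_psat.
  - by move=> a aq; apply/Eth => psi _; exact: aq.
  - apply/seteqP; split=> // a [/Eth aZ Xa]; apply: nF; exists a => psi Fpsi.
    have [qpsi|psiE] := Fq _ Fpsi; first exact: (aZ psi ((lP psi).1 Fpsi)).
    by rewrite psiE; exact/E.
- apply: (qX a); first by move=> psi qpsi; apply: aq; left.
  by apply/E/aq; right.
Qed.

End Automorphisms.

(** * Generic extensions of so-pairs *)

Section StationarilyOrdered.
Variables (L : language) (C : lstructure L) (K : Type).
Hypotheses (hom : strongly_homogeneous K C) (sat_C : saturated K C).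
Hypothesis natK : small K [set: nat].
Variables (A : set (elt C)) (xs : seq (lsort L)) (p : set (pformula C xs)).
Hypotheses (small_A : small K A) (pA : complete_type A p).
Local Notation P := (realization p).
Implicit Types (a b c d u v w x y z : P) (lt : relation P).

Lemma rtup_inj a b : rtup a = rtup b -> a = b.
Proof. by case: a b => [a pa] [b pb] /= ab; apply: eq_exist. Qed.

Lemma realizes_aut sigma a : aut_over A sigma -> realizes (tmap sigma (rtup a)) p.
Proof.
move=> sA phi pphi; have [pover _ _] := pA.
by apply/(psat_aut _ sA (pover _ pphi)); exact: (proj2_sig a).
Qed.

Definition act sigma (sA : aut_over A sigma) a : P :=
  exist _ (tmap sigma (rtup a)) (realizes_aut a sA).

Lemma homogeneous_p a b : exists2 sigma, aut_over A sigma & tmap sigma (rtup a) = rtup b.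
Proof.
have [_ _ pc] := pA; apply: (homogeneous hom natK small_A) => phi /pc[pphi _|pn Ha].
  exact: (proj2_sig b).
by have := proj2_sig a _ pn Ha.
Qed.

(** Agrees with [right_eventual] on an so-order, see [right_eventualP]; the reversed order gives the
    left version. *)
Definition ev lt (X : set P) : Prop := exists d, forall u, lt d u -> X u.

(* Weaker than [so_pair], but invariant under reversing the order, so that every
   statement about right generics dualizes. *)
Record so_order lt : Prop := {
  so_trans : forall x y z, lt x y -> lt y z -> lt x z;
  so_total : forall x y, [\/ lt x y, x = y | lt y x];
  so_aut : forall sigma (sA : aut_over A sigma) x y,
    lt x y -> lt (act sA x) (act sA y);
  so_succ : forall x, exists y, lt x y;
  so_pred : forall x, exists y, lt y x;
  so_gt : forall d, exists2 phi : pformula C xs, over (A `|` trange (rtup d)) phi &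
    forall u, psat phi (rtup u) <-> lt d u;
  so_lt : forall d, exists2 phi : pformula C xs, over (A `|` trange (rtup d)) phi &
    forall u, psat phi (rtup u) <-> lt u d;
  so_right : forall phi : pformula C xs, ev lt (trace p phi) \/ ev lt (~` trace p phi);
  so_left : forall phi : pformula C xs, ev (fun x y => lt y x) (trace p phi) \/
    ev (fun x y => lt y x) (~` trace p phi) }.

(** An automorphism carrying a smaller realization to a maximum would carry the maximum above
    itself, so a maximum would be the only realization of [p]. By compactness a formula of [p] would
    then isolate it. *)
Lemma nonalgebraic_no_max lt :
  (forall x, ~ lt x x) -> (forall x y, [\/ lt x y, x = y | lt y x]) ->
  (forall sigma (sA : aut_over A sigma) x y, lt x y -> lt (act sA x) (act sA y)) ->
  ~ algebraic p -> forall x, exists y, lt x y.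
Proof.
move=> irr tot aut nalg x; apply: contrapT => xmax; apply: nalg.
have px y : y = x.
  have [sigma sA E] := homogeneous_p y x.
  have yx : act sA y = x by exact: rtup_inj.
  case: (tot y x) => // [lyx|lxy]; case: xmax; last by exists y.
  by exists (act sA x); rewrite -{1}yx; exact: aut.
have sB : small K (A `|` trange (rtup x)).
  by apply: small_setU_finite => //; exact: finite_trange.
have [pover _ pcomp] := pA.
have [|||Y [[phi o E] YP YX]] := type_separation sat_C sB _ pover
    (X := ~` [set e | e = rtup x]).
- by left.
- by apply/definable_not/definable_eq => e; right.
- by move=> e ep; apply; rewrite -(px (exist _ e ep)).
exists phi.
  case: (pcomp _ o) => // npphi; have := proj2_sig x _ npphi; case.
  exact/E/YP/(proj2_sig x).
apply: (sub_finite_set _ (finite_set1 (rtup x))) => e /E Ye.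
apply: contrapT => ne; have : (set0 : set (tup C xs)) e; last by [].
by rewrite -YX.
Qed.

Lemma right_eventual_ev lt (X : set P) : right_eventual lt X -> ev lt X.
Proof. by move=> [S [[d Sd] fS SX]]; exists d => u du; apply: SX; exact: fS Sd du. Qed.

Lemma left_eventual_ev lt (X : set P) :
  left_eventual lt X -> ev (fun x y => lt y x) X.
Proof. by move=> [S [[d Sd] fS SX]]; exists d => u du; apply: SX; exact: fS Sd du. Qed.

Lemma so_pair_so_order lt : so_pair A lt -> ~ algebraic p -> so_order lt.
Proof.
move=> [_ [[irr trans] tot] [th oth ltE] dich] nalg.
have aut sigma (sA : aut_over A sigma) x y : lt x y -> lt (act sA x) (act sA y).
  by move=> /ltE H; apply/ltE; rewrite /= -tmap_tcat; exact/(psat_aut _ sA oth).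
have nomax := nonalgebraic_no_max irr tot aut nalg.
have nomin x : exists y, lt y x.
  apply: (@nonalgebraic_no_max (fun x y => lt y x)) => //.
  - by move=> a b; case: (tot a b) => H; [apply: Or33|apply: Or32|apply: Or31].
  - by move=> sigma sA a b; exact: aut.
split=> //.
- move=> d; have [|phi o E] := @definable_subst _ _ xs _ (A `|` trange (rtup d))
      (pform th) (fun e => tcat (tcat (rtup d) e) (ppar th)).
    apply: var_cat_ind; first apply: var_cat_ind; move=> s v.
    + right; exists (rtup d v); first by right; exists s, v.
      by move=> u; rewrite !tcat_vinl.
    + by left; exists v => u; rewrite tcat_vinl tcat_vinr.
    + right; exists (ppar th s v); first by left; exact: over_coord oth.
      by move=> u; rewrite tcat_vinr.
  by exists phi => // u; rewrite E ltE.
- move=> d; have [|phi o E] := @definable_subst _ _ xs _ (A `|` trange (rtup d))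
      (pform th) (fun e => tcat (tcat e (rtup d)) (ppar th)).
    apply: var_cat_ind; first apply: var_cat_ind; move=> s v.
    + by left; exists v => u; rewrite !tcat_vinl.
    + right; exists (rtup d v); first by right; exists s, v.
      by move=> u; rewrite tcat_vinl tcat_vinr.
    + right; exists (ppar th s v); first by left; exact: over_coord oth.
      by move=> u; rewrite tcat_vinr.
  by exists phi => // u; rewrite E ltE.
- move=> phi; have [|H _] := dich (trace p phi); first by exists phi.
  by case: H => -[]; [left|right]; exact: right_eventual_ev.
- move=> phi; have [|_ H] := dich (trace p phi); first by exists phi.
  by case: H => -[]; [left|right]; exact: left_eventual_ev.
Qed.

Lemma so_order_flip lt : so_order lt -> so_order (fun x y => lt y x).
Proof.
case=> Ht Hl Ha Hs Hp Hg Hlt Hr Hle; split=> //.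
- by move=> x y z xy yz; exact: Ht yz xy.
- by move=> x y; case: (Hl x y) => H; [apply: Or33|apply: Or32|apply: Or31].
- by move=> sigma sA x y; exact: Ha.
Qed.

(** * Right generics for a fixed order *)

Section OneOrder.
Variable lt : relation P.
Hypothesis so : so_order lt.

(* [gen B z] says that [z] realizes the right globalization restricted to [B],
   and [trig] is [tri] written with [ev] for [right_eventual]; see [tri_trig]. *)
Definition gen (B : set (elt C)) (z : P) : Prop :=
  forall phi : pformula C xs, over B phi -> ev lt (trace p phi) -> psat phi (rtup z).

Definition trig x z : Prop := gen (A `|` trange (rtup x)) z.

Lemma ev_and (X Y : set P) : ev lt X -> ev lt Y -> ev lt (X `&` Y).
Proof.
move=> [d dX] [e eY]; case: (so_total so d e) => [de|E|ed].
- by exists e => u eu; split; [apply: dX; exact: so_trans so _ _ _ de eu|exact: eY].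
- by subst e; exists d => u du; split; [exact: dX|exact: eY].
- by exists d => u du; split; [exact: dX|apply: eY; exact: so_trans so _ _ _ ed du].
Qed.

Lemma ev_nonempty (X : set P) : ev lt X -> X !=set0.
Proof. by move=> [d dX]; have [u /dX] := so_succ so d; exists u. Qed.

Lemma ev_list (I : Type) (l : list I) (X : I -> set P) (x : P) :
  (forall i, List.In i l -> ev lt (X i)) ->
  ev lt [set u | forall i, List.In i l -> X i u].
Proof.
elim: l => [_|i l IH H]; first by exists x => u _ i [].
have [d dH] : ev lt (X i `&` [set u | forall j, List.In j l -> X j u]).
  by apply: ev_and; [apply: H; left|apply: IH => j jl; apply: H; right].
by exists d => u /dH[Xi Xl] j [<-|jl]; [exact: Xi|exact: Xl].
Qed.

(** The right globalization is [A]-invariant: [sigma] carries the final segment beyond [d] to the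
    one beyond its image. *)
Lemma ev_pact sigma (phi : pformula C xs) : aut_over A sigma ->
  ev lt (trace p phi) -> ev lt (trace p (pact sigma phi)).
Proof.
move=> sA [d dphi]; exists (act sA d) => u du.
have [tau tA [sK tK]] := aut_over_inv sA.
have /dphi : lt d (act tA u).
  have := so_aut so tA du; congr lt; apply: rtup_inj; exact: tK.
by rewrite /trace /= -(psat_pact _ _ sA.1) /= sK.
Qed.

(** Finitely many eventual formulas meet, so saturation gives a realization; it realizes [p] since
    formulas of [p] hold on all of [p(C)] and so are eventual. *)
Lemma gen_exists (B : set (elt C)) x : small K B -> A `<=` B -> exists z, gen B z.
Proof.
move=> sB AB.
have [||z zP] := @sat_C B xs [set phi | over B phi /\ ev lt (trace p phi)] sB.
- by move=> phi [].
- move=> F /finite_set_listP[l lP] Fq.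
  have [|u uP] := ev_nonempty (@ev_list _ l (fun phi => trace p phi) x _).
    by move=> phi /lP/Fq[].
  by exists (rtup u) => phi /lP; exact: uP.
have zp : realizes z p.
  move=> phi pphi; apply: zP; split; last by exists x => u _; exact: (proj2_sig u).
  by have [pover _ _] := pA; exact: over_sub AB (pover _ pphi).
by exists (exist _ z zp) => phi o e; apply: zP.
Qed.

Lemma gen_sub (B B' : set (elt C)) z : B `<=` B' -> gen B' z -> gen B z.
Proof. by move=> sB H phi o; apply: H; exact: over_sub o. Qed.

(** Supplies right generics over [x] that lie beyond an arbitrary [y]. *)
Lemma trig_exists2 x y : exists2 z, trig x z & trig y z.
Proof.
have [||z zP] := @gen_exists (A `|` (trange (rtup x) `|` trange (rtup y))) x.
- by apply: small_setU_finite => //; rewrite finite_setU; split; exact: finite_trange.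
- by left.
by exists z; apply: gen_sub zP => e [Ae|Be]; [left|right; left|left|right; right].
Qed.

Lemma trig_lt x z : trig x z -> lt x z.
Proof.
by have [phi o E] := so_gt so x => /(_ phi o) H; apply/E/H; exists x => u /E.
Qed.

Lemma gen_psat (B : set (elt C)) z (phi : pformula C xs) :
  gen B z -> over B phi -> psat phi (rtup z) -> ev lt (trace p phi).
Proof.
move=> zP o H; case: (so_right so phi) => // e.
by have := zP (pnot phi) o e H.
Qed.

(** By [so_right] the globalization restricted to [A] and [x] is complete, so its realizations are
    conjugate. *)
Lemma trig_homog x z z' : trig x z -> trig x z' ->
  exists2 sigma, aut_over (A `|` trange (rtup x)) sigma & tmap sigma (rtup z) = rtup z'.
Proof.
move=> xz xz'; apply: (homogeneous hom natK).
  by apply: small_setU_finite => //; exact: finite_trange.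
by move=> phi o H; apply: xz' => //; exact: gen_psat xz o H.
Qed.

Lemma trig_act sigma (sA : aut_over A sigma) x z : trig x z -> trig (act sA x) (act sA z).
Proof.
move=> xz phi o e; have [tau tA [sK tK]] := aut_over_inv sA.
have := xz (pact tau phi); rewrite -{1}(tK _ (rtup z)) psat_pact; last exact: tA.1.
apply; last exact: ev_pact.
by rewrite -(tK _ (rtup x)); exact: over_pact.
Qed.

Lemma act_fix x sigma (sA : aut_over A sigma) :
  aut_over (A `|` trange (rtup x)) sigma -> act sA x = x.
Proof. by move=> sx; apply: rtup_inj; apply: tmap_fix sx _ => e; right. Qed.

Lemma aut_over_A x sigma : aut_over (A `|` trange (rtup x)) sigma -> aut_over A sigma.
Proof. by apply: aut_over_sub => e; left. Qed.

Lemma act_inv sigma (sA : aut_over A sigma) : exists tau (tA : aut_over A tau),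
  (forall x, act tA (act sA x) = x) /\ (forall x, act sA (act tA x) = x).
Proof.
have [tau tA [sK tK]] := aut_over_inv sA.
by exists tau, tA; split=> x; apply: rtup_inj; [exact: tK|exact: sK].
Qed.

Lemma trig_act_iff sigma (sA : aut_over A sigma) x z :
  trig (act sA x) (act sA z) <-> trig x z.
Proof.
split; last exact: trig_act.
by have [tau [tA [tK _]]] := act_inv sA; move/(@trig_act _ tA); rewrite !tK.
Qed.

Lemma so_above x y : exists t, lt x t /\ lt y t.
Proof.
have evx : ev lt (lt x) by exists x.
have evy : ev lt (lt y) by exists y.
by have [t [xt yt]] := ev_nonempty (ev_and evx evy); exists t.
Qed.

(** Say [phi] holds beyond [d]. An automorphism fixing [A] and [c] moves [b] to a generic beyond
    [d]; the image of [a] is then beyond [d] too, and the parameters of [phi] are fixed. *)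
Lemma trig_final c b a : trig c b -> lt b a -> trig c a.
Proof.
move=> cb ba phi o [d dphi].
have [b' cb' db'] := trig_exists2 c d.
have [sigma sc sb] := trig_homog cb cb'.
apply/(psat_aut _ sc o); apply: (dphi (act (aut_over_A sc) a)).
apply: (so_trans so) (trig_lt db') _.
have := so_aut so (aut_over_A sc) ba; congr lt; exact: rtup_inj.
Qed.

End OneOrder.

(* A formula separating [x] from the left generics over [y] yields an invariant
   [Phi u v] that holds for [u] far left of [y] and fails for [v] far right of
   [x]. Moving a point [t1] far on the left to a point [t2] far on the right by
   an automorphism over [A] makes these two facts collide. *)
Lemma trig_sym lt x y : so_order lt ->
  trig lt x y -> trig (fun a b => lt b a) y x.
Proof.
move=> so xy phi o [d dphi]; apply: contrapT => nx.
pose Phi u v := sat (pform phi)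
  (tcat (rtup u) (tmap (moved A (rtup y) (rtup v)) (ppar phi))).
have Phiy u : Phi u y <-> psat phi (rtup u).
  rewrite /Phi (_ : tmap _ _ = ppar phi) //.
  by apply: tup_ext => s v; exact: moved_id.
have Phi_act sigma (sA : aut_over A sigma) u v :
    Phi (act sA u) (act sA v) <-> Phi u v.
  rewrite /Phi -(sat_aut _ (tcat (rtup u) _) sA.1) tmap_tcat.
  rewrite (_ : tmap sigma (tmap _ _) =
    tmap (moved A (rtup y) (rtup (act sA v))) (ppar phi)) //.
  apply: tup_ext => s w; rewrite /tmap.
  have [Aw|nAw] := pselect (A (existT _ s (ppar phi s w))).
    by rewrite !moved_fix // sA.2.
  have [|w' [_ wE]] := @moved_coord _ _ A xs (rtup y) s (ppar phi s w) _ nAw.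
    exact: over_coord o.
  by rewrite !wE.
have [phi' o' E] : definable (A `|` trange (rtup x)) [set v |
    sat (pform phi) (tcat (rtup x) (tmap (moved A (rtup y) v) (ppar phi)))].
  apply: definable_subst; apply: var_cat_ind => s v.
    right; exists (rtup x v); first by right; exists s, v.
    by move=> a; rewrite tcat_vinl.
  have [Aw|nAw] := pselect (A (existT _ s (ppar phi s v))).
    right; exists (ppar phi s v); first by left.
    by move=> a; rewrite tcat_vinr /tmap moved_fix.
  have [|w [_ wE]] := @moved_coord _ _ A xs (rtup y) s (ppar phi s v) _ nAw.
    exact: over_coord o.
  by left; exists w => a; rewrite tcat_vinr /tmap wE.
(* Since [y] is right generic over [x] and [Phi x y] fails, [Phi x] fails eventually. *)
have [e eP] : ev lt (~` trace p phi').
  case: (so_right so phi') => // /(xy _ o')/E/Phiy/nx; case.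
have [t1 [t1y t1d]] := so_above (so_order_flip so) y d.
have [t2 [xt2 et2]] := so_above so x e.
have [sigma sA st12] := homogeneous_p t1 t2.
have t12 : act sA t1 = t2 by exact: rtup_inj.
have [tau [tA [tK sK]]] := act_inv sA.
have lt2 : lt t2 (act sA y).
  by rewrite -t12; exact: so_aut.
(* The point [act sA y] lies beyond [e], yet [Phi x (act sA y)] amounts to [Phi (act tA x) y], which
   holds since [act tA x] is below [t1] and so below [d]. *)
apply: (eP (act sA y)); first exact: so_trans so _ _ _ et2 lt2.
apply/E; change (Phi x (act sA y)).
rewrite -[X in Phi X _](sK x); apply/Phi_act/Phiy/dphi.
apply: (so_trans so) t1d.
by rewrite -(tK t1) t12; exact: (so_aut so tA xt2).
Qed.

(** If the type forked, some dividing [psi] in [D] would be eventual. Its conjugates over [A] are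
    eventual too, so any finitely many of them are jointly satisfiable, against dividing. *)
Lemma trig_independent lt x y : so_order lt -> trig lt y x ->
  independent A (rtup x) (rtup y).
Proof.
move=> so yx [F [D [/finite_set_listP[lF FP] Ftp /finite_set_listP[lD DP] Ddiv FD]]].
(* Otherwise the formulas of [F] and the negations of those of [D] are all eventual, hence have a
   common point. *)
have [psi Dpsi epsi] : exists2 psi, D psi & ev lt (trace p psi).
  apply: contrapT => nD.
  have e1 : ev lt [set u | forall phi, List.In phi lF -> trace p phi u].
    apply: (ev_list so x) => phi /FP/Ftp[o H]; exact: gen_psat yx o H.
  have e2 : ev lt [set u | forall phi, List.In phi lD -> (~` trace p phi) u].
    apply: (ev_list so x) => phi /DP Dphi.
    by case: (so_right so phi) => // H; case: nD; exists phi.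
  have [u [uF uD]] := ev_nonempty so (ev_and so e1 e2).
  have [|psi Dpsi] := FD (rtup u); first by move=> phi /FP; exact: uF.
  exact: (uD psi ((DP psi).1 Dpsi)).
have [b [k [bP kinc]]] := Ddiv _ Dpsi.
apply: (kinc (iota 0 k)); [exact: iota_uniq|exact: size_iota|].
have ebi i : ev lt (trace p (PFormula (pform psi) (b i))).
  have [|sigma sA <-] := homogeneous hom natK (b := ppar psi) (b' := b i) small_A.
    by move=> phi o H; exact: (bP i).
  exact: (ev_pact so (phi := psi)).
have [u uP] := ev_nonempty so
  (ev_list so (l := iota 0 k) x (fun i (_ : List.In i (iota 0 k)) => ebi i)).
exists (rtup u) => i ik; apply: (uP i); elim: (iota 0 k) ik => //= j l IH.
by rewrite in_cons => /orP[/eqP ->|/IH]; [left|right].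
Qed.

(** * Left and right generics together; forking *)

Section BothSides.
Variable lt : relation P.
Hypothesis so : so_order lt.
Local Notation rlt := (fun a b => lt b a).

Lemma trig_flip x y : trig lt x y <-> trig rlt y x.
Proof.
split; first exact: trig_sym.
exact: (trig_sym (so_order_flip so)).
Qed.

Lemma trig_initial u y z : lt u y -> trig lt y z -> trig lt u z.
Proof.
move=> uy /trig_flip yz; apply/trig_flip.
exact: (trig_final (so_order_flip so) yz uy).
Qed.

Lemma trig_trans x y z : trig lt x y -> trig lt y z -> trig lt x z.
Proof. by move=> xy yz; apply: trig_initial yz; exact: trig_lt xy. Qed.

(** If [y] is not generic over [x], some [phi] over [A] and [x] holds beyond [d] but fails at [y].
    Fixing [x], move [z] to a generic over [d]: the image of [y] is not beyond [d], so the image of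
    [z] is generic over it. *)
Lemma trig_weak x y z : trig lt x z -> trig lt x y \/ trig lt y z.
Proof.
move=> xz; have [|nxy] := pselect (trig lt x y); [by left|right].
have [phi /not_implyP[o /not_implyP[[d dphi] ny]]] := (existsNP _).2 nxy.
have [z' xz' dz'] := trig_exists2 so x d.
have [sigma sx sz] := trig_homog so xz xz'.
have sA := aut_over_A sx.
have sz' : act sA z = z' by exact: rtup_inj.
apply/(trig_act_iff so sA); rewrite sz'.
have nd : ~ lt d (act sA y).
  by move=> /dphi H; apply: ny; apply/(psat_aut _ sx o).
case: (so_total so d (act sA y)) => [//|<- //|yd].
exact: trig_initial yd dz'.
Qed.

(* The choice of [sigma] makes all pairs [(y, z)] with [trig lt y z] alike, so
   a Morley sequence over [A] starting with [y] witnesses 2-dividing. *)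
Lemma pairwise_disjoint_divides y sigma (sA : aut_over A sigma) (chi : pformula C xs) :
  over (A `|` trange (rtup y)) chi -> trig lt y (act sA y) ->
  (forall e, psat chi e -> ~ psat (pact sigma chi) e) -> divides A chi.
Proof.
move=> o yy chi_inc.
have [g gP] : exists g : P -> P, forall v, trig lt v (g v).
  have H v : exists w, trig lt v w.
    by have [w vw _] := trig_exists2 so v v; exists w.
  by exists (fun v => projT1 (cid (H v))) => v; exact: projT2 (cid (H v)).
pose ys n := iter n g y.
have ysP i j : (i < j)%N -> trig lt (ys i) (ys j).
  elim: j => // j IH; rewrite ltnS leq_eqVlt => /orP[/eqP ->|/IH ij].
    exact: gP.
  exact: trig_trans ij (gP _).
have [rho rhoP] : exists rho : nat -> forall s, C s -> C s,
    forall n, aut_over A (rho n) /\ tmap (rho n) (rtup y) = rtup (ys n).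
  have H n : exists r : forall s, C s -> C s,
      aut_over A r /\ tmap r (rtup y) = rtup (ys n).
    by have [r rA E] := homogeneous_p y (ys n); exists r.
  by exists (fun n => projT1 (cid (H n))) => n; exact: projT2 (cid (H n)).
have inc i j (e : tup C xs) : (i < j)%N ->
    psat (pact (rho i) chi) e -> psat (pact (rho j) chi) e -> False.
  move=> ij.
  have [[rAi Ei] [rAj Ej]] := (rhoP i, rhoP j).
  have [tau tA [K1 K2]] := aut_over_inv rAi.
  have Ei' : act rAi y = ys i by exact: rtup_inj.
  have ty : trig lt y (act tA (ys j)).
    apply/(trig_act_iff so rAi); rewrite Ei'.
    have -> : act rAi (act tA (ys j)) = ys j by apply: rtup_inj; exact: K1.
    exact: ysP.
  have [th thy Eth] := trig_homog so ty yy.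
  have thA := aut_over_A thy.
  (* [T] maps [ys i] to [y] and [ys j] to [act sA y], so it maps the two instances to [chi] and its
     image under [sigma], which are disjoint. *)
  pose T s (e' : C s) := th s (tau s e').
  have TA : aut_over A T := aut_over_comp tA thA.
  have idA : aut_over A (fun s (e' : C s) => e').
    by split=> //; split=> // s; exists id.
  have Ti : tmap T (tmap (rho i) (ppar chi)) = ppar chi.
    apply: (tmap_agree (aut_over_comp rAi TA) idA _ o).
    change (tmap th (tmap tau (tmap (rho i) (rtup y))) = rtup y).
    by rewrite K2; apply: (tmap_fix thy) => e' ?; right.
  have Tj : tmap T (tmap (rho j) (ppar chi)) = tmap sigma (ppar chi).
    apply: (tmap_agree (aut_over_comp rAj TA) sA _ o).
    change (tmap th (tmap tau (tmap (rho j) (rtup y))) = rtup (act sA y)).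
    by rewrite Ej -Eth.
  move=> /(psat_pact _ _ TA.1) Hi /(psat_pact _ _ TA.1) Hj.
  apply: (chi_inc (tmap T e)).
  - by move: Hi; rewrite /psat /= Ti.
  - by move: Hj; rewrite /psat /= Tj.
exists (fun n => tmap (rho n) (ppar chi)), 2; split.
  move=> n phi [ophi H].
  exact/(psat_aut _ (rhoP n).1 ophi).
move=> [|i [|j [|? ?]]] //= /andP[]; rewrite inE => ij _ _ [e eP].
have Hi : psat (pact (rho i) chi) e by apply: eP; rewrite inE eqxx.
have Hj : psat (pact (rho j) chi) e by apply: eP; rewrite !inE eqxx orbT.
by case: (ltngtP i j) ij => // [ij|ji] _; [exact: inc ij Hi Hj|exact: inc ji Hj Hi].
Qed.

Lemma incomparable_forks x y : ~ trig lt x y -> ~ trig lt y x ->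
  forks A (tp (rtup x) (A `|` trange (rtup y))).
Proof.
rewrite trig_flip => nl nr.
have [phi1 /not_implyP[o1 /not_implyP[[d1 dphi1] nx1]]] := (existsNP _).2 nl.
have [phi2 /not_implyP[o2 /not_implyP[[d2 dphi2] nx2]]] := (existsNP _).2 nr.
(* [phi1] holds left of [d1] and [phi2] right of [d2], while both fail at [x]. So [psi] confines its
   realizations in [p(C)] to the interval from [d1] to [d2]. *)
have [psi opsi Epsi] := definable_and (definable_psat (phi := pnot phi1) o1)
                                      (definable_psat (phi := pnot phi2) o2).
(* [d0], below [d1] and [y], is sent to [e], right generic over [d2] and [y]. Hence the image of the
   interval lies beyond [d2], and [act sA y] is right generic over [y]. *)
have [d0 [d0d1 d0y]] := so_above (so_order_flip so) d1 y.
have [e ye d2e] := trig_exists2 so y d2.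
have [sigma sA sd0] := homogeneous_p d0 e.
have {}sd0 : act sA d0 = e by exact: rtup_inj.
have yy : trig lt y (act sA y).
  by apply: (trig_final so ye); rewrite -sd0; exact: so_aut.
pose B := A `|` (trange (rtup y) `|` trange (rtup (act sA y))).
have sB : small K B.
  by apply: small_setU_finite => //; rewrite finite_setU; split; exact: finite_trange.
have AB : A `<=` B by left.
have [pover _ _] := pA.
have opsi' := over_pact sA opsi.
(* [psi] and its image are disjoint on [p(C)]; compactness extends this to all tuples in a set [Y]
   definable over [A] and containing [p(C)]. *)
have [||Y [[th oth Eth] YP YX]] := type_separation sat_C sB AB pover
    (X := [set e' | psat psi e'] `&` [set e' | psat (pact sigma psi) e']).
- apply: definable_and; apply: definable_psat.
  + by apply: over_sub opsi => u [|]; [left|right; left].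
  + by apply: over_sub opsi' => u [|]; [left|right; right].
- move=> e' e'p [/= He' He's]; pose u : P := exist _ e' e'p.
  have [_ n2] := (Epsi e').1 He'.
  have [tau [tA [tK sK]]] := act_inv sA; pose w := act tA u.
  have uE : tmap sigma (rtup w) = e' := congr1 (@rtup _ _ _ _) (sK u).
  have : psat psi (rtup w) by apply/(psat_pact _ _ sA.1); rewrite uE.
  move=> /Epsi[n1 _].
  have nw : ~ lt w d1 by move=> /dphi1.
  have d0w : lt d0 w.
    by case: (so_total so w d1) => [//|-> //|]; exact: (so_trans so).
  apply/n2/(dphi2 u)/(so_trans so (trig_lt so d2e)).
  by rewrite -sd0 -(sK u); exact: so_aut.
have [chi ochi Echi] := definable_and
  (definable_sub (fun e Ae => or_introl Ae) (ex_intro2 _ _ th oth Eth))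
  (definable_psat opsi).
have chi_div : divides A chi.
  apply: (pairwise_disjoint_divides ochi yy) => e' /Echi[Ye' psie'] He's.
  have [tau _ [tK _]] := aut_over_inv sA.
  have : psat chi (tmap tau e') by apply/(psat_pact _ _ sA.1); rewrite tK.
  move=> /Echi[_ /= H]; have : (set0 : set (tup C xs)) e'; last by [].
  rewrite -YX; split=> //; split=> //=.
  by rewrite -(tK _ e'); apply/psat_pact => //; exact: sA.1.
have xchi : psat chi (rtup x).
  apply/Echi; split; first exact/YP/(proj2_sig x).
  by apply/Epsi; split.
exists [set chi], [set chi]; split; [exact: finite_set1| |exact: finite_set1| |].
- by move=> _ ->.
- by move=> _ ->.
- by move=> e' H; exists chi => //; exact: H.
Qed.

(** Choose [y] generic over [x] and [z'] generic over both; an automorphism fixing [x] and moving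
    [z'] to [z] carries [y] in between. *)
Lemma trig_dense x z : trig lt x z -> exists y, trig lt x y /\ trig lt y z.
Proof.
move=> xz; have [y xy _] := trig_exists2 so x x.
have [z' yz' xz'] := trig_exists2 so y x.
have [sigma sx sz] := trig_homog so xz' xz; have sA := aut_over_A sx.
have sz' : act sA z' = z by exact: rtup_inj.
exists (act sA y); split; last by rewrite -sz'; exact: trig_act.
by rewrite -{1}(act_fix sA sx); exact: trig_act.
Qed.

(** Comparability makes [x] right or left generic over [y], so [trig_independent] applies to the
    order or to its reverse. *)
Lemma dep_incomparable x y : dep A p x y <-> incomparable (trig lt) x y.
Proof.
split=> [xy|[nxy nyx] H]; last by apply: H; exact: incomparable_forks.
split=> H; apply: xy; last exact: trig_independent so H.
exact: trig_independent (so_order_flip so) ((trig_flip _ _).1 H).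
Qed.

End BothSides.

(** * Back to the given notions of eventuality and genericity *)

Lemma right_eventualP lt (X : set P) : so_order lt -> right_eventual lt X <-> ev lt X.
Proof.
move=> so; split=> [|[d dX]]; first exact: right_eventual_ev.
exists [set u | lt d u]; split=> //; first exact: so_succ.
by move=> x y /= dx xy; exact: (so_trans so) dx xy.
Qed.

Lemma tri_trig lt : so_order lt -> tri A lt = trig lt.
Proof.
move=> so; apply/funext => x; apply/funext => z; apply/propext.
split=> H phi; first by move=> o /(right_eventualP _ so) e; exact: H.
by move=> [/(right_eventualP _ so) e o]; exact: H.
Qed.

End StationarilyOrdered.

Theorem theorem4 (L : language) (T : theory L) (hT : complete_theory T)
    (K : Type) (C : lstructure L) (hC : monster K T C)
    (A : set (elt C)) (hA : small K A)
    (xs : seq (lsort L)) (p : set (pformula C xs))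
    (ltp : relation (realization p)) (hp : so_pair A ltp)
    (hna : ~ algebraic p) :
  (StrictOrder (tri A ltp) /\ linear_extension (tri A ltp) ltp) /\
  [/\ forall x y : realization p,
        dep A p x y <-> incomparable (tri A ltp) x y,
      convex_equivalence ltp (dep A p) &
      dense_linear_order (quotient_lt ltp (dep A p))].
Proof.
have [[natK _ _ _] [_ satC homC]] := hC.
have [pA linp _ _] := hp.
have so := so_pair_so_order homC satC natK hA pA hp hna.
have triE : tri A ltp = trig A ltp := tri_trig so.
have depE : dep A p = incomparable (tri A ltp).
  apply/funext => x; apply/funext => y; apply/propext; rewrite triE.
  exact: (dep_incomparable homC satC natK hA so).
rewrite depE triE.
have triLt x y : trig A ltp x y -> ltp x y by exact: trig_lt.
have [R1 R2 R3] := weak_order_quotient linp triLt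
  (fun x y z xz => trig_weak homC satC natK hA so y xz)
  (fun x z xz => trig_dense homC satC natK hA so xz).
by split.
Qed.
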